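(* Let $p$ be a prime, let $G:=\mathrm{C}_p$ be the cyclic group of order $p$, and let $V:=\mathcal{F}(G,\mathbb{Q})$ be the regular representation of $G$ over the field $\mathbb{Q}$ of rational numbers. Then for any $v,w\in V$ with $G\cdot v\neq G\cdot w$ there exists an $f\in \mathbb{Q}[V]^G$ with $\deg(f)\le 3$ and $f(v)\neq f(w)$.
   Context: For a finite group $G$ and a field $\mathbb{F}$, $\mathcal{F}(G,\mathbb{F})$ denotes the $\mathbb{F}$-vector space of all functions $G\to\mathbb{F}$, on which $G$ acts linearly by $(g\cdot f)(h)=f(g^{-1}h)$ for $g,h\in G$; this is the regular representation of $G$ over $\mathbb{F}$. For a finite dimensional representation $V$ of $G$ over $\mathbb{F}$, $\mathbb{F}[V]$ is the coordinate ring of $V$, i.e. the polynomial algebra over $\mathbb{F}$ in $\dim_{\mathbb{F}}(V)$ variables, the variables being the coordinate functions on $V$ with respect to a basis, with the standard grading; $G$ acts on $\mathbb{F}[V]$ by $(g\cdot f)(v)=f(g^{-1}v)$, and $\mathbb{F}[V]^G$ is the subalgebra of $G$-invariant polynomials. $G\cdot v$ denotes the $G$-orbit of $v\in V$. *)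

(* Defs.v *)
From mathcomp Require Import all_boot all_order all_fingroup all_algebra.
From mathcomp Require Import all_solvable.
From mathcomp Require Export mpoly.

Set Implicit Arguments.
Unset Strict Implicit.
Unset Printing Implicit Defensive.

Import GRing.Theory.
Local Open Scope ring_scope.

Notation regular_rep gT F := {ffun gT -> F}.

(* The coordinates are those of the basis of delta functions: the variable    *)
(* 'X_i is the function v |-> v (enum_val i).                                 *)
Notation coord_ring gT F := {mpoly F[#|{: gT}|]}.

Section RegularRepresentation.

Variables (gT : finGroupType) (F : fieldType).

Definition reg_act (g : gT) (f : regular_rep gT F) : regular_rep gT F :=
  [ffun h : gT => f (g^-1 * h)%g].

Lemma reg_act1 v : reg_act 1%g v = v.
Proof. by apply/ffunP => h; rewrite ffunE invg1 mul1g. Qed.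

Lemma reg_actM g h v : reg_act (g * h)%g v = reg_act g (reg_act h v).
Proof. by apply/ffunP => k; rewrite !ffunE invMg mulgA. Qed.

Lemma reg_act_linear g :
  linear (reg_act g : {ffun gT -> F^o} -> {ffun gT -> F^o}).
Proof. by move=> a u v; apply/ffunP => h; rewrite !ffunE. Qed.

(* Listed with possible repetitions: orbits are to be compared with [=i]. *)
Definition reg_orbit (v : regular_rep gT F) : seq (regular_rep gT F) :=
  [seq reg_act g v | g : gT].

Definition coord_eval (f : coord_ring gT F) (v : regular_rep gT F) : F :=
  f.@[fun i => v (enum_val i)].

(* Since (g^-1 . v) h = v (g * h), the action (g . f)(v) = f (g^-1 . v) sends *)
(* the coordinate function at h to the one at g * h. It is defined on formal  *)
(* polynomials; [coord_eval_act] gives the formula on values.                 *)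
Definition coord_act (g : gT) (f : coord_ring gT F) : coord_ring gT F :=
  f \mPo [tuple 'X_(enum_rank (g * enum_val i)%g) | i < #|{: gT}|].

Lemma coord_eval_act g f v :
  coord_eval (coord_act g f) v = coord_eval f (reg_act g^-1%g v).
Proof.
rewrite /coord_eval comp_mpoly_meval; apply: meval_eq => i.
by rewrite tnth_mktuple mevalXU enum_rankK ffunE invgK.
Qed.

Definition coord_invariant (f : coord_ring gT F) : Prop :=
  forall g : gT, coord_act g f = f.

(* [msize f] is the total degree plus one for f != 0. *)
Definition coord_deg (f : coord_ring gT F) : nat := (msize f).-1.

End RegularRepresentation.

(* Main.v *)
(* Let A_k and B_k (k mod p) be the Fourier coefficients of v and w at the    *)
(* powers of a faithful character chi of G. The G-invariants                  *)
(* \sum_h \prod_(j < n) X_(h * a j) with n <= 3 determine every product of at *)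
(* most three coefficients whose frequencies sum to 0 mod p. If they agree on *)
(* v and w, then A_0 = B_0, and, as long as the A_k with k != 0 do not        *)
(* vanish, B_k / A_k is multiplicative in k, so B_k = c ^ k A_k with          *)
(* c ^ p = 1; then c = chi g for some g, and w = g . v. Over the rationals    *)
(* the coefficients with k != 0 are Galois conjugate, so that they either all *)
(* vanish, in which case v = w is constant, or are all nonzero.               *)
Require Import Defs.
From mathcomp Require Import all_boot all_order all_fingroup all_algebra.
From mathcomp Require Import all_solvable all_field all_character.
From mathcomp Require Import ring.

Set Implicit Arguments.
Unset Strict Implicit.
Unset Printing Implicit Defensive.

Import GRing.Theory Num.Theory.
Local Open Scope ring_scope.

(** The separating invariants are multiple correlations of at most three points. [prod_dft] turns
    their agreement into equality of products of Fourier coefficients; [dft_eq0], where rationality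
    enters, leaves two cases: all coefficients of nonzero frequency vanish or none does.
    [same_corr_orbit] recovers the translation in both, using Fourier inversion ([dft_inj]) and
    [chi_surj]. *)

Section MultipleCorrelation.

Variables (gT : finGroupType) (F : fieldType).
Implicit Types (v : regular_rep gT F).

Definition corr_poly n (a : {ffun 'I_n -> gT}) : coord_ring gT F :=
  \sum_(h : gT) \prod_(j < n) 'X_(enum_rank (h * a j)%g).

Lemma corr_poly_invariant n (a : {ffun 'I_n -> gT}) :
  coord_invariant (corr_poly a).
Proof.
move=> g; rewrite /coord_act /corr_poly rmorph_sum /=.
rewrite [RHS](reindex_inj (mulgI g)) /=; apply: eq_bigr => h _.
rewrite rmorph_prod /=; apply: eq_bigr => j _.
by rewrite comp_mpolyXU -tnth_nth tnth_mktuple enum_rankK mulgA.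
Qed.

Lemma coord_deg_corr_poly n (a : {ffun 'I_n -> gT}) :
  (coord_deg (corr_poly a) <= n)%N.
Proof.
rewrite /coord_deg -[leqRHS]/(n.+1.-1) -!subn1 leq_sub2r //.
apply: leq_trans (msize_sum _ _ _) _; apply/bigmax_leqP => h _.
rewrite mprodXE msizeX mdeg_sum (eq_bigr (fun=> 1%N)) => [|j _].
  by rewrite sum_nat_const card_ord muln1.
exact: mdeg1.
Qed.

Lemma coord_eval_corr_poly n (a : {ffun 'I_n -> gT}) v :
  coord_eval (corr_poly a) v = \sum_h \prod_j v (h * a j)%g.
Proof.
rewrite /coord_eval /corr_poly rmorph_sum; apply: eq_bigr => h _.
rewrite rmorph_prod; apply: eq_bigr => j _.
by rewrite /= mevalXU enum_rankK.
Qed.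

Lemma eq_reg_orbit g v w : w = reg_act g v -> reg_orbit v =i reg_orbit w.
Proof.
move=> -> z; apply/imageP/imageP => -[h _ ->].
  by exists (h * g^-1)%g => //; rewrite -reg_actM mulgKV.
by exists (h * g)%g => //; rewrite reg_actM.
Qed.

End MultipleCorrelation.

(** Irreducible characters of a cyclic group are linear. A kernel in a group of prime order is
    trivial or everything, and the kernels of all irreducible characters intersect trivially, so one
    of them is trivial. *)
Lemma faithful_lin_char_prime (gT : finGroupType) :
  prime #|[set: gT]| ->
  exists2 chi : 'CF([set: gT]), chi \is a linear_char & cfaithful chi.
Proof.
move=> G_prime; have cG := prime_cyclic G_prime.
have [i nfi | ker_all] := pickP (fun i : Iirr [set: gT] => cfaithful 'chi_i).
  by exists 'chi_i => //; apply: irr_cyclic_lin.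
have : [set: gT] \subset \bigcap_(i : Iirr [set: gT]) cfker 'chi_i.
  apply/bigcapsP => i _; apply/idPn => /(prime_TIg G_prime) kerI.
  by have := ker_all i; rewrite /cfaithful -kerI setTI subxx.
rewrite TI_cfker_irr => /subset_leq_card; rewrite cards1.
by rewrite leqNgt prime_gt1.
Qed.

Section Fourier.

Variables (gT : finGroupType) (p : nat).
Hypotheses (p_prime : prime p) (cardG : #|[set: gT]| = p).
Variable chi : 'CF([set: gT]).
Hypotheses (lin_chi : chi \is a linear_char) (inj_chi : cfaithful chi).
Implicit Types (v w : regular_rep gT rat) (x : gT).

(** Frequencies are natural numbers, with [p - k] standing for the frequency opposite to [k]. *)
Definition dft v (k : nat) : algC := \sum_x ratr (v x) * chi x ^+ k.

Let chiM : {morph chi : x y / (x * y)%g >-> x * y}.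
Proof. by move=> x y; apply: lin_charM; rewrite ?inE. Qed.

Lemma chi_expp x : chi x ^+ p = 1.
Proof.
rewrite -lin_charX ?inE // -cardG.
by rewrite expg_cardG ?inE // lin_char1.
Qed.

Lemma chi_eq1 x : (chi x == 1) = (x == 1%g).
Proof.
apply/eqP/eqP => [chix1 | ->]; last exact: lin_char1.
apply/set1gP; apply: (subsetP inj_chi).
by rewrite cfkerEchar ?lin_charW // !inE lin_char1 // chix1 eqxx.
Qed.

(** For any [x] other than 1, [chi x] is a primitive [p]-th root of unity, so its powers exhaust
    these roots. *)
Lemma chi_surj (c : algC) : c ^+ p = 1 -> exists x, c = chi x.
Proof.
move=> cp1; have [x xn1]: exists x : gT, x != 1%g.
  apply/existsP; rewrite -[[exists _, _]]negbK negb_exists.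
  apply: contraL (prime_gt1 p_prime) => /forallP all1.
  rewrite -cardG -leqNgt -(cards1 (1%g : gT)) subset_leq_card //.
  by apply/subsetP => y _; have := all1 y; rewrite negbK inE.
have [m prim_m] := prim_order_exists (prime_gt0 p_prime) (chi_expp x).
case/(primeP p_prime).2/pred2P => m_eq.
  have := prim_expr_order prim_m; rewrite m_eq expr1 => /eqP.
  by rewrite chi_eq1 (negPf xn1).
rewrite m_eq in prim_m; have [i ->] := prim_rootP prim_m cp1.
by exists (x ^+ i)%g; rewrite lin_charX ?inE.
Qed.

Lemma dft_act g v k : dft (reg_act g v) k = chi g ^+ k * dft v k.
Proof.
rewrite /dft (reindex_inj (mulgI g)) mulr_sumr; apply: eq_bigr => x _.
by rewrite ffunE mulKg chiM exprMn mulrCA.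
Qed.

Lemma sum_chi_exp x : \sum_(k < p) chi x ^+ k = p%:R *+ (x == 1%g).
Proof.
have [-> | xn1] := eqVneq x 1%g.
  rewrite (eq_bigr (fun=> 1)) => [|k _]; last by rewrite lin_char1 // expr1n.
  by rewrite sumr_const card_ord.
have /eqP := subrX1 (chi x) p; rewrite chi_expp subrr eq_sym mulf_eq0 subr_eq0.
by rewrite chi_eq1 (negPf xn1) => /eqP.
Qed.

Lemma dft_inj v w : (forall k, (k < p)%N -> dft v k = dft w k) -> v = w.
Proof.
(* Fourier inversion, from the orthogonality relation [sum_chi_exp]. *)
have inv u x : \sum_(k < p) dft u k * chi x^-1%g ^+ k = p%:R * ratr (u x).
  under eq_bigr do rewrite /dft mulr_suml.
  have sumE y : \sum_(k < p) ratr (u y) * chi y ^+ k * chi x^-1%g ^+ k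
      = ratr (u y) * (p%:R *+ (y == x)) :> algC.
    under eq_bigr do rewrite -mulrA -exprMn -chiM.
    by rewrite -mulr_sumr sum_chi_exp -eq_mulgV1.
  rewrite exchange_big (bigD1 x) //= sumE eqxx big1 ?addr0 1?mulrC // => y yx.
  by rewrite sumE (negPf yx) mulr0.
move=> eq_dft; apply/ffunP => x.
have p_neq0 : p%:R != 0 :> algC by rewrite pnatr_eq0 -lt0n prime_gt0.
apply: (fmorph_inj (@ratr algC)); apply: (mulfI p_neq0).
by rewrite -!inv; apply: eq_bigr => k _; rewrite eq_dft.
Qed.

(* The two coefficients are Galois conjugate, because v is rational.          *)
Lemma dft_eq0 v k : coprime k p -> (dft v k == 0) = (dft v 1 == 0).
Proof.
case/Qn_aut_exists => u uE; rewrite -(fmorph_eq0 u (dft v 1)) rmorph_sum.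
congr (_ == _); apply: eq_bigr => x _.
by rewrite rmorphM fmorph_rat expr1 uE ?chi_expp.
Qed.

(** Expand the product of coefficients over tuples [a]. Translating [a] by [h] multiplies the
    character factor by [chi h] to the power of the total frequency, which is 1. Summing over all
    [h] yields the correlations on one side and the factor [p] on the other. *)
Lemma prod_dft n (e : 'I_n -> nat) v : (p %| \sum_j e j)%N ->
  \sum_(a : {ffun 'I_n -> gT})
     ratr (coord_eval (corr_poly rat a) v) * \prod_j chi (a j) ^+ e j
  = p%:R * \prod_j dft v (e j).
Proof.
case/dvdnP => q sum_e.
transitivity (\sum_(h : gT) \prod_j dft v (e j)); last first.
  by rewrite sumr_const -cardsT cardG mulr_natl.
transitivity (\sum_(a : {ffun 'I_n -> gT}) \sum_(h : gT)
    ratr (\prod_j v (h * a j)%g) * \prod_j chi (a j) ^+ e j).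
  by apply: eq_bigr => a _; rewrite coord_eval_corr_poly rmorph_sum mulr_suml.
rewrite exchange_big; apply: eq_bigr => h _.
rewrite /dft bigA_distr_bigA /=.
pose shift (a : {ffun 'I_n -> gT}) := [ffun j => (h * a j)%g].
rewrite [RHS](reindex_inj (h := shift)) /=.
  apply: eq_bigr => a _; rewrite rmorph_prod -big_split /=.
  transitivity (chi h ^+ (\sum_j e j)
    * \prod_j (ratr (v (h * a j)%g) * chi (a j) ^+ e j)).
    by rewrite sum_e mulnC exprM chi_expp expr1n mul1r.
  rewrite expr_sum -big_split; apply: eq_bigr => j _ /=.
  by rewrite ffunE chiM exprMn mulrCA.
move=> a b /ffunP ab; apply/ffunP => j; have := ab j.
by rewrite !ffunE => /mulgI.
Qed.

Section SameInvariants.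

Variables v w : regular_rep gT rat.
Hypothesis same_corr : forall n (a : {ffun 'I_n -> gT}), (n <= 3)%N ->
  coord_eval (corr_poly rat a) v = coord_eval (corr_poly rat a) w.

Lemma eq_prod_dft n (e : 'I_n -> nat) : (n <= 3)%N -> (p %| \sum_j e j)%N ->
  \prod_j dft v (e j) = \prod_j dft w (e j).
Proof.
move=> n3 e0.
have p_neq0 : p%:R != 0 :> algC by rewrite pnatr_eq0 -lt0n prime_gt0.
apply: (mulfI p_neq0); rewrite -!prod_dft //.
by apply: eq_bigr => a _; rewrite same_corr.
Qed.

Lemma eq_dft0 : dft v 0 = dft w 0.
Proof.
by have := @eq_prod_dft 1 (fun=> 0%N) isT; rewrite !big_ord1 dvdn0 => ->.
Qed.

Lemma eq_dft2 i j : (p %| i + j)%N -> dft v i * dft v j = dft w i * dft w j.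
Proof.
have := @eq_prod_dft 2 (tnth [tuple i; j]) isT.
by rewrite !big_ord_recl !big_ord0 /= !mulr1 addn0.
Qed.

Lemma eq_dft3 i j k : (p %| i + j + k)%N ->
  dft v i * dft v j * dft v k = dft w i * dft w j * dft w k.
Proof.
have := @eq_prod_dft 3 (tnth [tuple i; j; k]) isT.
by rewrite !big_ord_recl !big_ord0 /= !mulr1 addn0 addnA !mulrA.
Qed.

Let coprime_lt k : (0 < k < p)%N -> coprime k p.
Proof.
by case/andP=> k0 kp; rewrite coprime_sym prime_coprime // gtnNdvd.
Qed.

Lemma same_corr_orbit : exists g, w = reg_act g v.
Proof.
have p1 := prime_gt1 p_prime; have p0 := ltnW p1.
have [v0 | v_neq0] := eqVneq (dft v 1) 0.
  exists 1%g; rewrite reg_act1; apply/esym/dft_inj => -[|k] kp.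
    exact: eq_dft0.
  have w0 : dft w 1 = 0.
    (* The coefficients of [w] at the opposite frequencies 1 and [p.-1] have product 0, and by
       conjugacy they vanish together. *)
    have := @eq_dft2 1 p.-1; rewrite add1n prednK // dvdnn => /(_ isT)/esym/eqP.
    rewrite v0 mul0r mulf_eq0.
    rewrite (@dft_eq0 w p.-1) ?orbb; first by move/eqP.
    by apply: coprime_lt; rewrite -!subn1 subn_gt0 p1 /= ltn_subrL p0.
  have ck : coprime k.+1 p by apply: coprime_lt.
  have dft0 u : dft u 1 = 0 -> dft u k.+1 = 0.
    by move=> u0; apply/eqP; rewrite dft_eq0 ?u0.
  by rewrite !dft0.
have vN0 k : (0 < k < p)%N -> dft v k != 0.
  by move/coprime_lt => ck; rewrite dft_eq0.
pose c := dft w 1 / dft v 1.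
have w1E : dft w 1 = c * dft v 1 by rewrite divfK.
have wE k : (k < p)%N -> dft w k = c ^+ k * dft v k.
  elim: k => [|k IHk] kp; first by rewrite mul1r eq_dft0.
  have [->|k_gt0] := posnP k; first by rewrite expr1 divfK.
  have kI : (0 < k < p)%N by rewrite k_gt0 ltnW.
  have lI : (0 < p - k.+1 < p)%N by rewrite subn_gt0 kp ltn_subrL.
  have kl : (p %| k.+1 + (p - k.+1))%N by rewrite subnKC ?dvdnn // ltnW.
  (* Multiplying [e3] by [dft w k.+1] makes the product in [e2] appear; the nonzero factors at 1,
     [k] and [p - k.+1] then cancel. *)
  have e2 := eq_dft2 kl; have e3 := @eq_dft3 1 k (p - k.+1) kl.
  move: e3; rewrite w1E (IHk (ltnW kp)) => e3.
  apply: (mulfI (mulf_neq0 (mulf_neq0 v_neq0 (vN0 k kI)) (vN0 _ lI))).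
  rewrite [X in X * _ = _]e3 exprS.
  transitivity (c * c ^+ k * dft v 1 * dft v k
    * (dft w k.+1 * dft w (p - k.+1))); first by ring.
  by rewrite -e2; ring.
have cp : c ^+ p = 1.
  have lI : (0 < p.-1 < p)%N by rewrite -!subn1 subn_gt0 p1 /= ltn_subrL p0.
  (* Here the pair of frequencies 1 and [p.-1] contributes the factor [c * c ^+ p.-1], which must be
     1. *)
  have := @eq_dft2 1 p.-1; rewrite add1n prednK // dvdnn => /(_ isT).
  rewrite w1E (wE p.-1) ?ltn_predL // mulrACA -exprS prednK //.
  rewrite -[LHS]mul1r; move/esym.
  exact: (mulIf (mulf_neq0 v_neq0 (vN0 _ lI))).
have [g cE] := chi_surj cp.
exists g; apply: dft_inj => k kp.
by rewrite dft_act -cE wE.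
Qed.

End SameInvariants.

End Fourier.

Local Close Scope ring_scope.

Theorem theorem4p1 (p : nat) (p_prime : prime p)
    (gT : finGroupType) (cyclicG : cyclic [set: gT]) (cardG : #|[set: gT]| = p)
    (v w : regular_rep gT rat) (vw : ~ (reg_orbit v =i reg_orbit w)) :
  exists f : coord_ring gT rat,
    [/\ coord_invariant f, coord_deg f <= 3 & coord_eval f v <> coord_eval f w].
Proof.
(* All quantifiers range over finite types, so the case distinction is decidable; ['I_4] encodes at
   most three points. *)
pose sep n := [exists a : {ffun 'I_n -> gT},
  coord_eval (corr_poly rat a) v != coord_eval (corr_poly rat a) w].
have [/existsP[n /existsP[a /eqP neq]] | /existsPn same] :=
    boolP [exists n : 'I_4, sep n].
  exists (corr_poly rat a); split=> //; first exact: corr_poly_invariant.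
  exact: leq_trans (coord_deg_corr_poly rat a) (leq_ord n).
have [|chi lin_chi inj_chi] := @faithful_lin_char_prime gT.
  by rewrite cardG.
case: vw; suff [g]: exists g, w = reg_act g v by apply: eq_reg_orbit.
apply: (same_corr_orbit p_prime cardG lin_chi inj_chi) => n a n3.
by have /existsPn/(_ a)/negPn/eqP := same (Ordinal (n3 : n < 4)%N).
Qed.
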